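(* There exists a sequence $\{f_n\}_{n=0}^{\infty}\subseteq \ell^{2}(\mathbb{N})$ that is an ICFC sequence and is incomplete, i.e. $\overline{\operatorname{span}\{f_n\}}\neq \ell^2(\mathbb{N})$.
   Context: A sequence $\{h_n\}$ in a Hilbert space $\mathcal{H}$ is a Parseval frame if $\|f\|^2=\sum_n|\langle f,h_n\rangle|^2$ for all $f\in \mathcal{H}$. A sequence $\{f_n\}_{n=0}^\infty\subseteq\mathcal{H}$ is an ICFC sequence if there is an injective bounded linear operator $B\in B(\mathcal{H})$ such that $\{Bf_n\}$ is a Parseval frame in $\mathcal{H}$. Here $\mathcal{H}=\ell^2(\mathbb{N})$. *)

(* Defs.v *)
From HB Require Import structures.
From mathcomp Require Import all_boot all_order all_algebra.
From mathcomp Require Import complex ring lra.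
From mathcomp Require Import all_classical all_reals all_analysis.

Set Implicit Arguments.
Unset Strict Implicit.
Unset Printing Implicit Defensive.

Import Order.TTheory GRing.Theory Num.Theory.
Import numFieldNormedType.Exports Normc.

Local Open Scope classical_set_scope.
Local Open Scope ring_scope.
Local Open Scope complex_scope.

HB.instance Definition _ (R : realType) := NormedModule.copy R[i] R[i]^o.

Section complex_topology.
Context {R : realType}.
Implicit Types z : R[i].

Lemma normc_norm z : `|z| = (normc z)%:C.
Proof. by case: z. Qed.

Lemma normc_sqr z : normc z ^+ 2 = complex.Re z ^+ 2 + complex.Im z ^+ 2.
Proof. by case: z => a b /=; rewrite sqr_sqrtr// addr_ge0// sqr_ge0. Qed.

Lemma normc_ge0 z : 0 <= normc z.
Proof. by case: z => a b /=; rewrite sqrtr_ge0. Qed.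

Lemma ler_normcD z z' : normc (z + z') <= normc z + normc z'.
Proof. by rewrite -lecR rmorphD/= -!normc_norm; exact: ler_normD. Qed.

Lemma Re_le_normc z : `|complex.Re z| <= normc z.
Proof. by rewrite -lecR -normc_norm normc_ge_Re. Qed.

Lemma Im_le_normc z : `|complex.Im z| <= normc z.
Proof.
by case: z => a b /=; rewrite -sqrtr_sqr ler_wsqrtr// lerDr sqr_ge0.
Qed.

Lemma normc_le_ReIm z : normc z <= `|complex.Re z| + `|complex.Im z|.
Proof.
rewrite -(@ler_pXn2r _ 2)// ?nnegrE ?normc_ge0 ?addr_ge0// normc_sqr.
rewrite sqrrD !real_normK ?num_real//.
have : 0 <= `|complex.Re z| * `|complex.Im z| by rewrite mulr_ge0.
lra.
Qed.

Lemma cvg_complex {T} {F : set_system T} {FF : Filter F} (f : T -> R[i]) z :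
  f @ F --> z <->
  ((@complex.Re R \o f) @ F --> (complex.Re z : R)) /\
  ((@complex.Im R \o f) @ F --> (complex.Im z : R)).
Proof.
split=> [fz|[fre fim]].
  split; apply/cvgrPdist_lt => e e0.
    have : 0 < e%:C by rewrite ltcR.
    move/cvgrPdist_lt : fz => /[apply]; apply: filterS => x /=.
    rewrite normc_norm ltcR; apply: le_lt_trans.
    by rewrite -raddfB Re_le_normc.
  have : 0 < e%:C by rewrite ltcR.
  move/cvgrPdist_lt : fz => /[apply]; apply: filterS => x /=.
  rewrite normc_norm ltcR; apply: le_lt_trans.
  by rewrite -raddfB Im_le_normc.
apply/cvgrPdist_lt => -[e i]; rewrite ltcE/= => /andP[/eqP-> e0].
have e20 : 0 < e / 2 by rewrite divr_gt0.
move/cvgrPdist_lt : fre => /(_ _ e20) Hre.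
move/cvgrPdist_lt : fim => /(_ _ e20) Him.
apply: filterS2 Hre Him => x /= Hre Him.
rewrite normc_norm ltcR; apply: le_lt_trans (normc_le_ReIm _) _.
by rewrite !raddfB/= [ltRHS]splitr ltrD.
Qed.

Lemma complex_complete (F : set_system R[i]) :
  ProperFilter F -> cauchy F -> cvg F.
Proof.
move=> FF /cauchyP Fc; apply/cvg_ex.
have part (p : R[i] -> R) :
    (forall z z', `|p z - p z'| <= normc (z - z')) -> cvg (p @ F).
  move=> pl; apply/cauchy_cvgP/cauchyP => e e0.
  have e0C : 0 < e%:C by rewrite ltcR.
  have [z Fz] := Fc _ e0C.
  exists (p z); suff : F (p @^-1` ball (p z) e) by [].
  apply: filterS Fz => z'; rewrite -!ball_normE/= => zz'.
  by apply: le_lt_trans (pl _ _) _; rewrite -ltcR -normc_norm.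
have /cvg_ex[a Ha] : cvg (@complex.Re R @ F).
  by apply: part => z z'; rewrite -raddfB Re_le_normc.
have /cvg_ex[b Hb] : cvg (@complex.Im R @ F).
  by apply: part => z z'; rewrite -raddfB Im_le_normc.
by exists (a +i* b); apply/(@cvg_complex _ _ _ id).
Qed.

HB.instance Definition _ := Uniform_isComplete.Build R[i] complex_complete.

End complex_topology.

(* The inner product is linear in its first argument. In R[i] the norm takes
   its values in the nonnegative reals embedded in R[i], and x <= y holds only
   when x and y have the same imaginary part. *)
HB.mixin Record NormedModule_hasInner (R : realType) H
    & NormedModule R[i] H := {
  inner : H -> H -> R[i];
  innerDl : forall x y z, inner (x + y) z = inner x z + inner y z;
  innerZl : forall a x z, inner (a *: x) z = a * inner x z;
  inner_conj : forall x y, inner y x = (inner x y)^*;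
  innerxx : forall x, inner x x = `|x| ^+ 2
}.

#[short(type="hilbertType")]
HB.structure Definition Hilbert (R : realType) :=
  {H of CompleteNormedModule R[i] H & NormedModule_hasInner R H}.

Section frames.
Context {R : realType} {H : hilbertType R}.
Implicit Types f h : nat -> H.

Definition parseval_frame h : Prop :=
  forall x : H,
    series (fun n => `|inner x (h n)| ^+ 2) @ \oo --> `|x| ^+ 2.

Definition bounded_operator (B : {linear H -> H}) : Prop :=
  exists M : R, forall x : H, `|B x| <= M%:C * `|x|.

Definition icfc_sequence f : Prop :=
  exists B : {linear H -> H},
    [/\ bounded_operator B, injective B & parseval_frame (B \o f)].

Definition seq_span f : set H :=
  [set x | exists (n : nat) (c : nat -> R[i]), x = \sum_(k < n) c k *: f k].

End frames.

Section square_summable.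
Context {R : realType}.
Implicit Types f g : nat -> R[i].
Local Open Scope ereal_scope.

Definition sumsq f : \bar R := \sum_(0 <= k <oo) (normc (f k) ^+ 2)%:E.

Definition square_summable : {pred nat -> R[i]} :=
  [pred f | sumsq f < +oo].

End square_summable.

Section square_summable_theory.
Context {R : realType}.
Implicit Types f g : nat -> R[i].

Lemma sumsq_ge0 f : (0 <= sumsq f)%E.
Proof. by apply: nneseries_ge0 => n _ _; rewrite lee_fin sqr_ge0. Qed.

Lemma sumsq_fin f : square_summable f -> sumsq f \is a fin_num.
Proof. by move=> ff; rewrite ge0_fin_numE// sumsq_ge0. Qed.

Lemma le_sumsq f n :
  square_summable f -> \sum_(k < n) normc (f k) ^+ 2 <= fine (sumsq f).
Proof.
move=> ff; rewrite -lee_fin fineK ?sumsq_fin// -sumEFin.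
rewrite -(big_mkord xpredT (fun k => (normc (f k) ^+ 2)%:E)).
by apply: nneseries_lim_ge => k _ _; rewrite lee_fin sqr_ge0.
Qed.

Lemma sumsq_le f (M : R) :
  (forall n, \sum_(k < n) normc (f k) ^+ 2 <= M) -> (sumsq f <= M%:E)%E.
Proof.
move=> fM; apply: lime_le.
  by apply: is_cvg_nneseries => k _ _; rewrite lee_fin sqr_ge0.
by apply: nearW => n; rewrite big_mkord sumEFin lee_fin.
Qed.

Lemma square_summableP f :
  square_summable f <-> exists M : R, forall n, \sum_(k < n) normc (f k) ^+ 2 <= M.
Proof.
split=> [ff|[M fM]]; first by exists (fine (sumsq f)) => n; exact: le_sumsq.
exact: le_lt_trans (sumsq_le fM) (ltry _).
Qed.

Lemma cvg_sumsq f : square_summable f ->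
  series (fun k => normc (f k) ^+ 2) @ \oo --> fine (sumsq f).
Proof.
move=> ff.
have h : (fun n => (series (fun k => normc (f k) ^+ 2) n)%:E) @ \oo
    --> (fine (sumsq f))%:E.
  rewrite fineK ?sumsq_fin//.
  have h : cvgn (fun n => \sum_(0 <= k < n) (normc (f k) ^+ 2)%:E)%E.
    by apply: is_cvg_nneseries => k _ _; rewrite lee_fin sqr_ge0.
  by rewrite /series/=; under eq_fun do rewrite -sumEFin; exact: h.
by move/fine_cvgP: h => [].
Qed.

(* The library's minkowski inequality is about Lnorm, hence real powers. *)
Lemma minkowski_sum (a b : nat -> R) n :
  (forall k, 0 <= a k) -> (forall k, 0 <= b k) ->
  Num.sqrt (\sum_(k < n) (a k + b k) ^+ 2) <=
  Num.sqrt (\sum_(k < n) a k ^+ 2) + Num.sqrt (\sum_(k < n) b k ^+ 2).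
Proof.
move=> a0 b0; elim: n => [|n IH]; first by rewrite !big_ord0 sqrtr0 addr0.
have sq0 c : 0 <= \sum_(k < n) (c k : R) ^+ 2.
  by apply: sumr_ge0 => k _; exact: sqr_ge0.
rewrite !big_ord_recr/=; move: IH.
have A0 := sq0 a; have B0 := sq0 b; have S0 := sq0 (fun k => a k + b k).
move: A0; move: (\sum_(k < n) a k ^+ 2) => A A0.
move: B0; move: (\sum_(k < n) b k ^+ 2) => B B0.
move: S0 => /=; move: (\sum_(k < n) _) => S S0 IH.
rewrite -(@ler_pXn2r _ 2)// ?nnegrE ?addr_ge0 ?sqrtr_ge0//.
rewrite [leRHS]sqrrD !sqr_sqrtr ?addr_ge0 ?sqr_ge0//.
have {}IH : S <= A + B + 2 * (Num.sqrt A * Num.sqrt B).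
  move: IH; rewrite -(@ler_pXn2r _ 2)// ?nnegrE ?addr_ge0 ?sqrtr_ge0//.
  by rewrite sqrrD !sqr_sqrtr// mulr2n; lra.
have : Num.sqrt A * Num.sqrt B + a n * b n <=
    Num.sqrt (A + a n ^+ 2) * Num.sqrt (B + b n ^+ 2).
  rewrite -(@ler_pXn2r _ 2)// ?nnegrE ?addr_ge0 ?mulr_ge0 ?sqrtr_ge0//.
  rewrite [leRHS]exprMn !sqr_sqrtr ?addr_ge0 ?sqr_ge0//.
  rewrite -[in leRHS](sqr_sqrtr A0) -[in leRHS](sqr_sqrtr B0).
  have := sqr_ge0 (Num.sqrt A * b n - Num.sqrt B * a n).
  by rewrite -subr_ge0; congr (0 <= _); ring.
move=> H; rewrite -mulr_natl; lra.
Qed.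

Lemma normc_minkowski f g n :
  Num.sqrt (\sum_(k < n) normc (f k + g k) ^+ 2) <=
  Num.sqrt (\sum_(k < n) normc (f k) ^+ 2) +
  Num.sqrt (\sum_(k < n) normc (g k) ^+ 2).
Proof.
have := @minkowski_sum (fun k => normc (f k)) (fun k => normc (g k)) n
  (fun=> normc_ge0 _) (fun=> normc_ge0 _).
apply: le_trans; apply: ler_wsqrtr; apply: ler_sum => k _ /=.
by rewrite ler_sqr ?nnegrE ?addr_ge0 ?normc_ge0// ler_normcD.
Qed.

Lemma sumsqD f g n : square_summable f -> square_summable g ->
  \sum_(k < n) normc (f k + g k) ^+ 2 <=
  (Num.sqrt (fine (sumsq f)) + Num.sqrt (fine (sumsq g))) ^+ 2.
Proof.
move=> ff gg; rewrite -[leLHS]sqr_sqrtr; last first.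
  by apply: sumr_ge0 => k _; exact: sqr_ge0.
rewrite ler_sqr ?nnegrE ?addr_ge0 ?sqrtr_ge0//.
apply: le_trans (normc_minkowski _ _ _) _.
by rewrite lerD// ler_wsqrtr// le_sumsq.
Qed.

Lemma square_summable_submod : submod_closed (@square_summable R).
Proof.
split=> [|a f g ff gg].
  apply/square_summableP; exists 0 => n.
  by rewrite big1// => k _; rewrite normc0 expr0n.
apply/square_summableP.
have aff : square_summable (a *: f).
  apply/square_summableP; exists (normc a ^+ 2 * fine (sumsq f)) => n.
  under eq_bigr do rewrite normcM exprMn.
  by rewrite -mulr_sumr ler_wpM2l ?sqr_ge0// le_sumsq.
by eexists => n; exact: sumsqD.
Qed.

HB.instance Definition _ := GRing.isSubmodClosed.Build R[i] (nat -> R[i])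
  (@square_summable R) square_summable_submod.

End square_summable_theory.

Record l2 (R : realType) := L2 {
  l2_seq :> nat -> R[i];
  l2_summable : l2_seq \in square_summable
}.

HB.instance Definition _ (R : realType) := [isSub for @l2_seq R].
HB.instance Definition _ (R : realType) := [Choice of l2 R by <:].
HB.instance Definition _ (R : realType) :=
  [SubChoice_isSubLmodule of l2 R by <:].

Definition l2_norm (R : realType) (f : l2 R) : R[i] :=
  (Num.sqrt (fine (sumsq f)))%:C.

Definition l2_inner (R : realType) (f g : l2 R) : R[i] :=
  limn (series (fun k => f k * (g k)^*)).

Section l2_normed.
Context {R : realType}.
Implicit Types f g : l2 R.

Lemma l2P f : square_summable f.
Proof. exact: l2_summable. Qed.

Lemma l2_ext f g : (forall k, f k = g k) -> f = g.
Proof. by move=> fg; apply/val_inj/funext. Qed.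

Lemma l2_normD f g : l2_norm (f + g) <= l2_norm f + l2_norm g.
Proof.
rewrite -rmorphD lecR -(@ler_pXn2r _ 2)// ?nnegrE ?addr_ge0 ?sqrtr_ge0//.
rewrite sqr_sqrtr ?fine_ge0 ?sumsq_ge0//.
rewrite -lee_fin fineK ?sumsq_fin//; last exact: l2P.
by apply: sumsq_le => n; apply: sumsqD; exact: l2P.
Qed.

Lemma l2_normZ (a : R[i]) f : l2_norm (a *: f) = `|a| * l2_norm f.
Proof.
rewrite normc_norm -rmorphM; congr _%:C.
have -> : sumsq (a *: f) = ((normc a ^+ 2)%:E * sumsq f)%E.
  rewrite /sumsq -nneseriesZl; last by move=> k _; rewrite lee_fin sqr_ge0.
  by apply: eq_eseriesr => k _; rewrite -EFinM -exprMn -normcM.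
rewrite fineM ?sumsq_fin//; last exact: l2P.
by rewrite sqrtrM ?sqr_ge0// sqrtr_sqr ger0_norm ?normc_ge0.
Qed.

Lemma normc_le_l2_norm f k : `|f k| <= l2_norm f.
Proof.
rewrite normc_norm lecR -(@ler_pXn2r _ 2)// ?nnegrE ?normc_ge0 ?sqrtr_ge0//.
rewrite sqr_sqrtr ?fine_ge0 ?sumsq_ge0//.
apply: le_trans (le_sumsq k.+1 (l2P f)).
by rewrite big_ord_recr/= lerDr sumr_ge0// => i _; exact: sqr_ge0.
Qed.

Lemma l2_norm0_eq0 f : l2_norm f = 0 -> f = 0.
Proof.
move=> f0; apply: l2_ext => k; apply/eqP; rewrite -normr_le0 -f0.
exact: normc_le_l2_norm.
Qed.

HB.instance Definition _ := Lmodule_isNormed.Build R[i] (l2 R)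
  l2_normD l2_normZ l2_norm0_eq0.

Lemma l2_normE f : `|f| = l2_norm f. Proof. by []. Qed.

Lemma l2_complete (F : set_system (l2 R)) :
  ProperFilter F -> cauchy F -> cvg F.
Proof.
move=> FF Fc.
have lim k : exists z : R[i], (fun f : l2 R => f k) @ F --> z.
  apply/cvg_ex/cauchy_cvgP/cauchyP => e e0.
  have /cauchyP/(_ _ e0)[f Ff] := Fc.
  exists (f k); suff : F ((fun f : l2 R => f k) @^-1` ball (f k) e) by [].
  apply: filterS Ff => f'; rewrite -!ball_normE/=.
  by apply: le_lt_trans; exact: (normc_le_l2_norm (f - f')).
have [g0 g0P] := choice lim.
have near_g (e : R) : 0 < e -> exists2 A, F A & forall f, A f ->
    forall n, \sum_(k < n) normc (f k - g0 k) ^+ 2 <= e ^+ 2.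
  move=> e0.
  have e0C : 0 < e%:C by rewrite ltcR.
  have /cauchy_ballP/(_ _ e0C)[[A B]/= [FA FB] AB] := Fc.
  exists A => // f Af n.
  have h : (\sum_(k < n) normc (f k - (f' : l2 R) k) ^+ 2) @[f' --> F] -->
      \sum_(k < n) normc (f k - g0 k) ^+ 2.
    apply: (cvg_big (@add_continuous R)) => // k _.
    have /cvg_complex[hr hi] : (f k - (f' : l2 R) k) @[f' --> F] --> f k - g0 k.
      by apply: cvgB (g0P k); exact: cvg_cst.
    rewrite normc_sqr; under eq_fun do rewrite normc_sqr.
    by apply: cvgD; rewrite expr2; under eq_fun do rewrite expr2;
      apply: cvgM.
  rewrite -(cvg_lim _ h)//; apply: limr_le; first exact: cvgP h.
  apply: filterS FB => f' Bf'.
  have := AB (f, f') (conj Af Bf'); rewrite /= -ball_normE/= l2_normE => ltfe.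
  rewrite -(@ler_sqrt _ _ (e ^+ 2)) ?sqr_ge0// sqrtr_sqr (gtr0_norm e0).
  rewrite -lecR; apply: le_trans (ltW ltfe); rewrite lecR ler_wsqrtr//.
  exact: (le_sumsq n (l2P (f - f'))).
have g0P2 : g0 \in square_summable.
  have [A FA AP] := near_g 1 ltr01.
  have [f Af] := filter_ex FA.
  have fg0 : (f : nat -> R[i]) - g0 \in square_summable.
    by apply/square_summableP; exists (1 ^+ 2) => n; exact: AP.
  have -> : g0 = (f : nat -> R[i]) - ((f : nat -> R[i]) - g0) by rewrite subKr.
  by apply: rpredB => //; exact: l2_summable.
apply/cvg_ex; exists (L2 g0P2); apply/cvgrPdist_le => -[e i].
rewrite ltcE/= => /andP[/eqP-> e0].
have [A FA AP] := near_g e e0.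
apply: filterS FA => f Af; rewrite distrC l2_normE lecR.
rewrite -(@ler_pXn2r _ 2)// ?nnegrE ?sqrtr_ge0 ?(ltW e0)//.
rewrite sqr_sqrtr ?fine_ge0 ?sumsq_ge0//.
rewrite -lee_fin fineK ?sumsq_fin//; last exact: l2P.
by apply: sumsq_le => n; exact: AP.
Qed.

HB.instance Definition _ := Uniform_isComplete.Build (l2 R) l2_complete.

Lemma cvg_l2_inner f g :
  series (fun k => f k * (g k)^* ) @ \oo --> l2_inner f g.
Proof.
suff : cvgn (series (fun k => f k * (g k)^* )) by [].
pose u k := f k * (g k)^*.
have ule k : normc (u k) <= normc (f k) ^+ 2 + normc (g k) ^+ 2.
  rewrite /u normcM.
  have -> : normc (g k)^* = normc (g k) by case: (g k) => a b /=; rewrite sqrrN.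
  have := sqr_ge0 (normc (f k) - normc (g k)).
  have := sqr_ge0 (normc (f k) + normc (g k)).
  nra.
have part (p : R[i] -> R) : (forall z, `|p z| <= normc z) ->
    cvgn (series (p \o u)).
  move=> ple; apply: normed_cvg.
  apply: (@series_le_cvg _ _ (fun k => normc (f k) ^+ 2 + normc (g k) ^+ 2)).
  - by move=> k /=.
  - by move=> k; rewrite addr_ge0// sqr_ge0.
  - by move=> k /=; apply: le_trans (ple _) (ule k).
  - by apply: is_cvg_seriesD; apply: cvgP (cvg_sumsq (l2P _)).
have /cvg_ex[a Ha] := part _ (@Re_le_normc _).
have /cvg_ex[b Hb] := part _ (@Im_le_normc _).
apply/cvg_ex; exists (a +i* b); apply/cvg_complex; split.
- apply: cvg_trans Ha; apply: near_eq_cvg; apply: nearW => n.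
  by rewrite /series/= raddf_sum.
- apply: cvg_trans Hb; apply: near_eq_cvg; apply: nearW => n.
  by rewrite /series/= raddf_sum.
Qed.

Lemma l2_inner_unique f g (z : R[i]) :
  series (fun k => f k * (g k)^* ) @ \oo --> z -> l2_inner f g = z.
Proof. by move=> h; apply/cvg_lim => //; exact: norm_hausdorff. Qed.

Lemma l2_innerDl f g h : l2_inner (f + g) h = l2_inner f h + l2_inner g h.
Proof.
apply: l2_inner_unique.
have -> : series (fun k => (f + g) k * (h k)^* ) =
    series (fun k => f k * (h k)^* ) \+ series (fun k => g k * (h k)^* ).
  apply/funext => n; rewrite /series/= -big_split/=.
  by apply: eq_bigr => k _; rewrite -mulrDl.
by apply: cvgD; exact: cvg_l2_inner.
Qed.

Lemma l2_innerZl (a : R[i]) f h : l2_inner (a *: f) h = a * l2_inner f h.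
Proof.
apply: l2_inner_unique.
have -> : series (fun k => (a *: f) k * (h k)^* ) =
    (fun n => a * series (fun k => f k * (h k)^* ) n).
  apply/funext => n; rewrite /series/= mulr_sumr.
  by apply: eq_bigr => k _; rewrite mulrA.
by apply: cvgMl_tmp; exact: cvg_l2_inner.
Qed.

Lemma l2_inner_conj f g : l2_inner g f = (l2_inner f g)^*.
Proof.
apply: l2_inner_unique; apply/cvg_complex.
have /cvg_complex[hr hi] := @cvg_l2_inner f g.
have conjE n : series (fun k => g k * (f k)^* ) n =
    (series (fun k => f k * (g k)^* ) n)^*.
  rewrite /series/= rmorph_sum; apply: eq_bigr => k _.
  by rewrite rmorphM/= conjcK mulrC.
have -> : series (fun k => g k * (f k)^* ) =
    (fun n => (series (fun k => f k * (g k)^* ) n)^*) by exact/funext.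
have ReC z : complex.Re z^* = complex.Re z :> R by case: z.
have ImC z : complex.Im z^* = - complex.Im z :> R by case: z.
rewrite ReC ImC /comp; split.
- by under eq_fun do rewrite ReC; exact: hr.
- by under eq_fun do rewrite ImC; exact: cvgN hi.
Qed.

Lemma l2_innerxx f : l2_inner f f = `|f| ^+ 2.
Proof.
apply: l2_inner_unique; rewrite l2_normE -rmorphXn sqr_sqrtr; last first.
  by rewrite fine_ge0 ?sumsq_ge0.
have E n : series (fun k => f k * (f k)^* ) n =
    (series (fun k => normc (f k) ^+ 2) n)%:C.
  rewrite /series/= rmorph_sum; apply: eq_bigr => k _.
  by rewrite -sqr_normc normc_norm rmorphXn.
have -> : series (fun k => f k * (f k)^* ) =
    (fun n => (series (fun k => normc (f k) ^+ 2) n)%:C) by exact/funext.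
apply/cvg_complex; split.
- exact: cvg_sumsq (l2P f).
- exact: cvg_cst.
Qed.

HB.instance Definition _ := NormedModule_hasInner.Build R (l2 R)
  l2_innerDl l2_innerZl l2_inner_conj l2_innerxx.

End l2_normed.

(* Main.v *)
Require Import Defs.
From HB Require Import structures.
From mathcomp Require Import all_boot all_order all_algebra.
From mathcomp Require Import complex ring lra.
From mathcomp Require Import all_classical all_reals all_analysis.

Set Implicit Arguments.
Unset Strict Implicit.
Unset Printing Implicit Defensive.

Import Order.TTheory GRing.Theory Num.Theory.
Import numFieldNormedType.Exports Normc.

Local Open Scope classical_set_scope.
Local Open Scope ring_scope.
Local Open Scope complex_scope.

(** Write [e_n] for the standard orthonormal basis of l2. The frame is obtained
    by pulling this basis back through an operator [B] that maps a closed
    hyperplane onto a dense subspace and yet is injective on the whole space.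

    Concretely, [B x = (2^-k (x_{k+1} + x_0))_k]. On the hyperplane [x_0 = 0]
    it is the diagonal operator [D] with weights [2^-k], whose range contains
    every [e_n]: indeed [B (2^n e_{n+1}) = e_n]. The remaining direction [e_0]
    is sent to [(2^-k)_k]. This sequence is in l2, so [B] is bounded, but it
    is the formal image under [D] of the constant sequence 1, which is not in
    l2; it therefore lies outside the range of [D], and [B] is injective
    ([fold_op_injective]).

    Hence [f_n = 2^n e_{n+1}] is an ICFC sequence, as its image [(e_n)] is
    Parseval ([parseval_unit_vec]). It is incomplete because every [f_n] is
    orthogonal to [e_0] ([common_zero_coord_incomplete]). *)

Section l2_coordinates.
Context {R : realType}.
Implicit Types x y : l2 R.

Lemma l2_coordD x y k : (x + y) k = x k + y k. Proof. by []. Qed.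

Lemma l2_coordB x y k : (x - y) k = x k - y k. Proof. by []. Qed.

Lemma l2_coordZ a x k : (a *: x) k = a * x k. Proof. by []. Qed.

End l2_coordinates.

Section unit_vectors.
Context {R : realType}.

Lemma sum_mul_delta (V : pzRingType) (F : nat -> V) (n m : nat) :
  \sum_(k < m) F k * (k == n :> nat)%:R = if (n < m)%N then F n else 0.
Proof.
rewrite -(big_ord1_eq +%R) [RHS]big_mkcond/=; apply: eq_bigr => k _.
by case: eqP => _; rewrite ?mulr1 ?mulr0.
Qed.

Lemma unit_seq_summable (n : nat) :
  (fun k => (k == n)%:R : R[i]) \in square_summable.
Proof.
apply/square_summableP; exists 1 => m.
rewrite (eq_bigr (fun k : 'I_m => 1 * (k == n :> nat)%:R)); last first.
  by move=> k _; case: eqP => _; rewrite ?normc1 ?normc0 ?expr1n ?expr0n ?mul1r.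
by rewrite (@sum_mul_delta _ (fun=> 1)); case: ifP.
Qed.

Definition unit_vec (n : nat) : l2 R := L2 (unit_seq_summable n).

Lemma inner_unit_vec (x : l2 R) n : inner x (unit_vec n) = x n.
Proof.
apply: l2_inner_unique; apply: cvg_near_cst; exists n.+1 => // m /= nm.
rewrite /series/= big_mkord -[RHS](_ : (if (n < m)%N then x n else 0) = _).
  rewrite -(sum_mul_delta x); apply: eq_bigr => k _.
  by rewrite rmorph_nat.
by rewrite nm.
Qed.

(** With [<x, e_n> = x_n], the Parseval identity is the definition of the l2
    norm, transported from real to complex-valued series. *)
Lemma parseval_unit_vec : parseval_frame unit_vec.
Proof.
move=> x.
have -> : series (fun n => `|inner x (unit_vec n)| ^+ 2) =
    (fun n => (series (fun k => normc (x k) ^+ 2) n)%:C).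
  apply/funext => n; rewrite /series/= rmorph_sum; apply: eq_bigr => k _.
  by rewrite inner_unit_vec normc_norm rmorphXn.
rewrite l2_normE -rmorphXn sqr_sqrtr ?fine_ge0 ?sumsq_ge0//.
by apply/cvg_complex; split; [exact: cvg_sumsq (l2P x) | exact: cvg_cst].
Qed.

End unit_vectors.

Section folding_operator.
Context {R : realType}.
Implicit Types x : l2 R.

Definition fold_seq x (k : nat) : R[i] := 2%:R ^- k * (x k.+1 + x 0%N).

(** The closed form [4/3 (1 - 4^-n)] is at most 2. *)
Lemma sum_geo_quarter n : \sum_(k < n) (2^-1 : R) ^+ k ^+ 2 <= 2.
Proof.
suff -> : \sum_(k < n) (2^-1 : R) ^+ k ^+ 2 = 4 / 3 * (1 - 2^-1 ^+ n ^+ 2).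
  have := sqr_ge0 ((2^-1 : R) ^+ n); lra.
elim: n => [|n IH]; first by rewrite big_ord0 expr0 expr1n subrr mulr0.
by rewrite big_ord_recr/= IH (exprS _ n); field.
Qed.

(** Each coordinate satisfies [|x_{k+1} + x_0| <= 2 |x|], and the squares of the
    weights sum to at most 2; the resulting factor 8 is rounded up to 9 so that
    the operator bound is the integer 3. *)
Lemma sum_fold_seq_le x n :
  \sum_(k < n) normc (fold_seq x k) ^+ 2 <= 9 * fine (sumsq x).
Proof.
have S0 : 0 <= fine (sumsq x) by rewrite fine_ge0 ?sumsq_ge0.
have xle k : normc (x k) <= Num.sqrt (fine (sumsq x)).
  by rewrite -lecR -normc_norm; exact: normc_le_l2_norm.
apply: (@le_trans _ _ (\sum_(k < n) 4 * fine (sumsq x) * 2^-1 ^+ k ^+ 2)).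
  apply: ler_sum => k _.
  have -> : normc (fold_seq x k) = 2^-1 ^+ k * normc (x k.+1 + x 0%N).
    rewrite normcM; congr (_ * _).
    apply: complexI; rewrite -normc_norm normrV ?unitfE ?expf_neq0//.
    rewrite ger0_norm ?exprn_ge0// exprVn.
    by rewrite rmorphV ?unitfE ?expf_neq0// rmorphXn rmorph_nat.
  rewrite exprMn mulrC ler_wpM2r ?sqr_ge0//.
  rewrite -(sqr_sqrtr S0) (_ : 4 = 2 ^+ 2); last by ring.
  rewrite -exprMn ler_sqr ?nnegrE ?normc_ge0 ?mulr_ge0 ?sqrtr_ge0//.
  apply: le_trans (ler_normcD _ _) _.
  by rewrite mulr_natl mulr2n lerD.
rewrite -mulr_sumr; have := sum_geo_quarter n; nra.
Qed.

Lemma fold_seq_summable x : fold_seq x \in square_summable.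
Proof.
apply/square_summableP; exists (9 * fine (sumsq x)).
exact: sum_fold_seq_le.
Qed.

Definition fold_op x : l2 R := L2 (fold_seq_summable x).

Lemma fold_op_linear : linear fold_op.
Proof.
move=> a x y; apply: l2_ext => k.
rewrite l2_coordD l2_coordZ /= /fold_seq !l2_coordD !l2_coordZ; ring.
Qed.

HB.instance Definition _ :=
  GRing.isLinear.Build R[i] (l2 R) (l2 R) *:%R fold_op fold_op_linear.

Lemma fold_op_bounded : bounded_operator fold_op.
Proof.
exists 3 => x; rewrite !l2_normE -rmorphM lecR.
have S0 : 0 <= fine (sumsq x) by rewrite fine_ge0 ?sumsq_ge0.
rewrite -(@ler_pXn2r _ 2)// ?nnegrE ?mulr_ge0 ?sqrtr_ge0//.
rewrite exprMn !sqr_sqrtr ?fine_ge0 ?sumsq_ge0//.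
rewrite -lee_fin fineK ?sumsq_fin//; last exact: l2P.
apply: sumsq_le => n; apply: le_trans (sum_fold_seq_le x n) _.
by rewrite (_ : 3 ^+ 2 = 9)//; ring.
Qed.

(** The terms of a convergent series tend to 0, so a nonzero constant tail is
    not square summable. The shift is the one that occurs in the kernel of the
    operator. *)
Lemma l2_cst_eq0 x (c : R[i]) : (forall k, x k.+1 = c) -> c = 0.
Proof.
move=> xc.
have h := cvg_series_cvg_0 (cvgP _ (cvg_sumsq (l2P x))).
have : (fun=> normc c ^+ 2) @ \oo --> (0 : R).
  apply: cvg_trans h; apply: near_eq_cvg; exists 1%N => // -[|k]//= _.
  by rewrite xc.
move/(cvg_unique (@Rhausdorff R) (cvg_cst _)) => /eqP.
by rewrite sqrf_eq0 => /eqP /eq0_normc.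
Qed.

(** If [B x = 0] then [x_{k+1} = - x_0] for all [k], so square summability
    forces [x_0 = 0], and then every coordinate vanishes. *)
Lemma fold_op_injective : injective fold_op.
Proof.
suff ker0 x : fold_op x = 0 -> x = 0.
  move=> x y xy; apply/eqP; rewrite -subr_eq0; apply/eqP/ker0.
  by rewrite raddfB/= xy subrr.
move=> Bx0.
have xS k : x k.+1 = - x 0%N.
  apply/eqP; rewrite -addr_eq0.
  have /eqP : fold_op x k = 0 by rewrite Bx0.
  by rewrite /= mulf_eq0 invr_eq0 expf_eq0 pnatr_eq0 andbF.
have x0 := l2_cst_eq0 xS.
apply: l2_ext => -[|k]; last by rewrite xS x0.
by apply/eqP; rewrite -oppr_eq0 x0.
Qed.

Lemma fold_op_unit_vec n :
  fold_op (2%:R ^+ n *: unit_vec n.+1) = unit_vec n.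
Proof.
apply: l2_ext => k; rewrite /= /fold_seq !l2_coordZ /=.
rewrite mulr0 addr0 eqSS; case: eqP => [->|_]; last by rewrite !mulr0.
by rewrite mulr1 mulVf// expf_neq0// pnatr_eq0.
Qed.

End folding_operator.

(** All elements of the span vanish at coordinate [j], hence are at distance at
    least 1 from the unit vector [e_j]. *)
Lemma common_zero_coord_incomplete (R : realType) (f : nat -> l2 R) (j : nat) :
  (forall n, f n j = 0) -> closure (seq_span f) <> [set: l2 R].
Proof.
move=> fj0 dense.
have : closure (seq_span f) (unit_vec j) by rewrite dense.
move/(_ _ (nbhsx_ballx (unit_vec j) (1 : R[i]) ltr01)) => [y [[n [c ->]]]].
rewrite -ball_normE/= => ylt1.
have yj0 : (\sum_(k < n) c k *: f k) j = 0.
  elim: n {ylt1} => [|n IH]; first by rewrite big_ord0.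
  rewrite big_ord_recr.
  by rewrite l2_coordD l2_coordZ IH fj0 mulr0 addr0.
have := le_lt_trans (normc_le_l2_norm _ j) ylt1.
by rewrite l2_coordB yj0 subr0 /= eqxx normr1 ltxx.
Qed.

Theorem theorem3p5 (R : realType) :
  exists f : nat -> l2 R,
    icfc_sequence f /\ closure (seq_span f) <> [set: l2 R].
Proof.
exists (fun n => 2%:R ^+ n *: unit_vec n.+1); split.
  exists fold_op; split.
  - exact: fold_op_bounded.
  - exact: fold_op_injective.
  - rewrite (_ : _ \o _ = unit_vec); first exact: parseval_unit_vec.
    by apply/funext => n; exact: fold_op_unit_vec.
by apply: (@common_zero_coord_incomplete _ _ 0%N) => n; exact: mulr0.
Qed.
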